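(* Let $\mathcal{C}$ be a linear $(n,k,d,r,\delta)$-LRC over the finite field $\mathbb{F}_q$ (that is, an $[n,k,d]$ linear code over $\mathbb{F}_q$ with all-symbol locality $(r,\delta)$, where $r,\delta$ are positive integers), and let $\kappa_B$ be an integer which is an upper bound on the dimension of linear codes over $\mathbb{F}_q$ of length $r+\delta-1$ and minimum distance at least $\delta$. Then $$k \leq \min_{\lambda \in \mathbb{Z}_{+}} \left\{ \lambda + k_{\mathrm{opt}}^{(q)}\bigl(n-(a+1)\,\mathcal{G}(\kappa_B, \delta) + \mathcal{G}(\kappa_B - b, \delta),\, d \bigr) \right\},$$ where, for each $\lambda$, the integers $a,b$ are determined by $\lambda = a \kappa_B + b$, $0 \leq b < \kappa_B$.
   Context: $\mathbb{Z}_+=\{0,1,2,\dots\}$ and $[n]=\{1,\dots,n\}$. An $[n,k,d]$ linear code over $\mathbb{F}_q$ has length $n$, dimension $k\ge 1$ and minimum (Hamming) distance $d$. For $I\subseteq[n]$, $\mathcal{C}|_I=\{\mathbf{c}_I:\mathbf{c}\in\mathcal{C}\}$. The zero code is regarded as having infinite minimum distance. Locality: an $[n,k,d]$ linear code $\mathcal{C}$ has all-symbol locality $(r,\delta)$ if for every $i\in[n]$ there is a set $R\subseteq[n]$ (a repair set) with (1) $i\in R$, (2) $|R|\le r+\delta-1$, (3) the minimum distance of $\mathcal{C}|_R$ is at least $\delta$. Griesmer function over $\mathbb{F}_q$: $\mathcal{G}(k,d)=\sum_{i=0}^{k-1}\lceil d/q^i\rceil$ (so $\mathcal{G}(0,d)=0$).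 $k_{\mathrm{opt}}^{(q)}(m,d)$ is the largest dimension of a linear code over $\mathbb{F}_q$ of length $m$ and minimum distance at least $d$; it equals $0$ if there is no such nonzero code (in particular if $m<d$, including $m\le 0$). *)

(* Defs.v *)
From HB Require Import structures.
From mathcomp Require Import all_boot all_order all_algebra.

Set Implicit Arguments.
Unset Strict Implicit.
Unset Printing Implicit Defensive.

Import GRing.Theory.
Local Open Scope ring_scope.

(* Linear codes of length n over F are subspaces of 'rV[F]_n. *)

Definition hamming_dist (F : finFieldType) (n : nat) (x y : 'rV[F]_n) : nat :=
  #|[set i | x 0 i != y 0 i]|.

(* Vacuously true of the zero code, whose minimum distance is infinite. *)
Definition min_dist_ge (F : finFieldType) (n : nat) (C : {vspace 'rV[F]_n})
    (d : nat) : bool :=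
  [forall x : 'rV[F]_n, forall y : 'rV[F]_n,
    [&& x \in C, y \in C & x != y] ==> (d <= hamming_dist x y)%N].

Definition has_min_dist (F : finFieldType) (n : nat) (C : {vspace 'rV[F]_n})
    (d : nat) : Prop :=
  min_dist_ge C d /\
  exists x y : 'rV[F]_n,
    [/\ x \in C, y \in C, x != y & hamming_dist x y = d].

Definition linear_code (F : finFieldType) (n k d : nat)
    (C : {vspace 'rV[F]_n}) : Prop :=
  [/\ \dim C = k, (1 <= k)%N & has_min_dist C d].

Definition restr_word (F : finFieldType) (n : nat) (I : {set 'I_n})
    (x : 'rV[F]_n) : 'rV[F]_#|I| :=
  \row_(j < #|I|) x 0 (enum_val j).

Lemma restr_word_is_linear (F : finFieldType) (n : nat) (I : {set 'I_n}) :
  linear (@restr_word F n I).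
Proof. by move=> a x y; apply/rowP => j; rewrite !mxE. Qed.

HB.instance Definition _ (F : finFieldType) (n : nat) (I : {set 'I_n}) :=
  GRing.isLinear.Build F 'rV[F]_n 'rV[F]_#|I| _ (@restr_word F n I)
    (@restr_word_is_linear F n I).

Definition restr_code (F : finFieldType) (n : nat) (C : {vspace 'rV[F]_n})
    (I : {set 'I_n}) : {vspace 'rV[F]_#|I|} :=
  (linfun (@restr_word F n I) @: C)%VS.

Definition all_symbol_locality (F : finFieldType) (n r delta : nat)
    (C : {vspace 'rV[F]_n}) : Prop :=
  forall i : 'I_n, exists R : {set 'I_n},
    [/\ i \in R, (#|R| <= r + delta - 1)%N & min_dist_ge (restr_code C R) delta].

Definition ceil_div (m p : nat) : nat := (m %/ p + ~~ (p %| m))%N.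

(* q is the size of the field. *)
Definition griesmer (q k d : nat) : nat := (\sum_(i < k) ceil_div d (q ^ i))%N.

(* A subspace is represented by a canonical matrix, so over a finite field
   there are finitely many. *)
Definition vspace_isCountable (F : finFieldType) (vT : vectType F) :
    isCountable {vspace vT} :=
  CanIsCountable (@VectorInternalTheory.vs2mxK F vT).
HB.instance Definition _ (F : finFieldType) (vT : vectType F) :=
  @vspace_isCountable F vT.
Definition vspace_isFinite (F : finFieldType) (vT : vectType F) :
    isFinite {vspace vT} :=
  CanIsFinite (@VectorInternalTheory.vs2mxK F vT).
HB.instance Definition _ (F : finFieldType) (vT : vectType F) :=
  @vspace_isFinite F vT.

(* The zero code always qualifies, so the maximum is 0 when no nonzero code
   does. *)
Definition kopt_nat (F : finFieldType) (m d : nat) : nat :=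
  (\max_(C : {vspace 'rV[F]_m} | min_dist_ge C d) \dim C)%N.

Definition kopt (F : finFieldType) (m : int) (d : nat) : nat :=
  match m with
  | Posz m' => kopt_nat F m' d
  | Negz _ => 0%N
  end.

Definition dim_upper_bound (F : finFieldType) (m d kappa : nat) : Prop :=
  forall D : {vspace 'rV[F]_m}, min_dist_ge D d -> (\dim D <= kappa)%N.

Definition is_minimum (f : nat -> nat) (m : nat) : Prop :=
  (exists i, f i = m) /\ (forall i, (m <= f i)%N).

(* Main.v *)
(* A hyperplane of a code of dimension [x] and minimum distance [delta] can be
   chosen so as to kill at least [ceil (delta / q ^ (x - 1))] coordinates: this
   is an average over the points of the projective space. Inside a repair set
   [R] one cuts [C] down by hyperplanes, losing supports of sizes
   [ceil (delta / q ^ (x - 1)), ..., ceil (delta / q ^ 0)], where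
   [x = dim (C|_R) <= kappaB]; once [C|_R = 0] one moves on to another repair
   set. After [lambda] steps the loss is at least the sum of the first [lambda]
   terms of the periodic repetition of this sequence with [x = kappaB], which is
   [(a + 1) G(kappaB, delta) - G(kappaB - b, delta)]. What is left is a code of
   dimension [k - lambda] and minimum distance at least [d], and deleting the
   coordinates outside its support gives the bound. *)
Require Import Defs.
From mathcomp Require Import all_boot all_order all_algebra.
From mathcomp Require Import zify.

Set Implicit Arguments.
Unset Strict Implicit.
Unset Printing Implicit Defensive.

Import GRing.Theory.
Local Open Scope ring_scope.

(** * Ceilings of quotients and windows of a periodic sequence *)

Lemma ceil_div_leq (d p M : nat) : (0 < p)%N ->
  (ceil_div d p <= M)%N = (d <= M * p)%N.
Proof.
rewrite /ceil_div => p_gt0; have := divn_eq d p; have := ltn_pmod d p_gt0.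
rewrite /dvdn; case: eqVneq => [-> _ | ] /=.
  by rewrite !addn0 => ->; rewrite mulnK // leq_pmul2r.
rewrite -lt0n; move: (d %/ p)%N (d %% p)%N => u v v_gt0 v_lt ->.
by apply/idP/idP; nia.
Qed.

Lemma leq_ceil_div (d p1 p2 : nat) : (0 < p1 <= p2)%N ->
  (ceil_div d p2 <= ceil_div d p1)%N.
Proof.
case/andP=> p1_gt0 le_p; rewrite ceil_div_leq ?(leq_trans p1_gt0) //.
by apply: leq_trans (leq_mul (leqnn _) le_p); rewrite -ceil_div_leq.
Qed.

(** The window of length [l] from position [s] in the periodic repetition of
    [g (kappa - 1), ..., g 0]. *)
Definition periodic_sum (g : nat -> nat) (kappa s l : nat) : nat :=
  (\sum_(i < l) g (kappa.-1 - (s + i) %% kappa))%N.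

Section PeriodicSum.

Variables (g : nat -> nat) (kappa : nat).
Local Notation Phi := (periodic_sum g kappa).

Lemma periodic_sumD s l m : Phi s (l + m) = (Phi s l + Phi (s + l) m)%N.
Proof.
rewrite /periodic_sum big_split_ord /=; congr addn.
by apply: eq_bigr => i _; rewrite addnA.
Qed.

Lemma periodic_sum_period s l : Phi (s + kappa) l = Phi s l.
Proof. by apply: eq_bigr => i _; rewrite addnAC modnDr. Qed.

Lemma periodic_sum_recl s l :
  Phi s l.+1 = (g (kappa.-1 - s %% kappa) + Phi s.+1 l)%N.
Proof.
rewrite /periodic_sum big_ord_recl addn0; congr addn.
by apply: eq_bigr => i _; rewrite /= /bump /= addnA addn1.
Qed.

Lemma periodic_sum_rev l : (l <= kappa)%N ->
  (\sum_(i < kappa - l) g i + Phi 0 l = \sum_(i < kappa) g i)%N.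
Proof.
move=> le_l; rewrite -[in RHS](subnK le_l) big_split_ord /=; congr addn.
rewrite /periodic_sum (reindex_inj rev_ord_inj) /=.
apply: eq_bigr => i _; congr g.
by rewrite add0n modn_small; have := ltn_ord i; lia.
Qed.

(** For [g i] the ceiling of [delta / q ^ i] this evaluates the window from 0 as [(a + 1) G(kappa,
    delta) - G(kappa - b, delta)]; the additive form avoids truncated subtraction. *)
Lemma periodic_sum_full a b : (b <= kappa)%N ->
  (Phi 0 (a * kappa + b) + \sum_(i < kappa - b) g i
    = a.+1 * \sum_(i < kappa) g i)%N.
Proof.
move=> le_b; rewrite periodic_sumD add0n mulSn.
have -> : Phi (a * kappa) b = Phi 0 b.
  by elim: a => // a IHa; rewrite mulSn addnC periodic_sum_period.
have -> : Phi 0 (a * kappa) = (a * \sum_(i < kappa) g i)%N.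
  elim: a => [|a IHa]; first by rewrite mul0n /periodic_sum big_ord0.
  rewrite !mulSn periodic_sumD periodic_sum_period IHa.
  by rewrite -(periodic_sum_rev (leqnn kappa)) subnn big_ord0.
by have := periodic_sum_rev le_b; lia.
Qed.

Hypothesis kappa_gt0 : (0 < kappa)%N.
Hypothesis g_anti : forall i j, (i <= j)%N -> (g j <= g i)%N.

(** Neither window wraps around, and within one period the terms are nondecreasing. *)
Lemma periodic_sum_mono y s m : (y <= s)%N -> (s + m <= kappa)%N ->
  (Phi y m <= Phi s m)%N.
Proof.
move=> le_ys le_sm; apply: leq_sum => i _; apply: g_anti.
by rewrite !modn_small; have := ltn_ord i; lia.
Qed.

(* Starting a period at its smallest values minimises every window. *)
Lemma periodic_sum_min s l : (s <= kappa)%N -> (Phi 0 l <= Phi s l)%N.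
Proof.
move=> le_s; elim/ltn_ind: l => l IHl.
have [le_kl | lt_lk] := leqP kappa l.
  rewrite -(subnKC le_kl) !periodic_sumD !periodic_sum_period leq_add //; last first.
    by apply: IHl; lia.
  (* A full period has the same sum from every offset: split the window of length [s + kappa] from 0
     in two ways. *)
  rewrite -(leq_add2l (Phi 0 s)) -[X in (_ <= _ + Phi X _)%N]add0n -periodic_sumD.
  by rewrite [(s + _)%N]addnC periodic_sumD periodic_sum_period addnC.
have [? | lt_sl] := leqP (s + l) kappa; first exact: periodic_sum_mono.
(* The window from [s] wraps and its last [y] terms are the first [y] of the window from 0.
   Cancelling them leaves two windows of length [kappa - s], from [y] and from [s], neither of which
   wraps. *)
set y := (s + l - kappa)%N.
have El : l = (y + (kappa - s))%N by rewrite /y; lia.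
have Esl : (s + l = kappa + y)%N by rewrite /y; lia.
have := periodic_sumD 0 s l; rewrite Esl periodic_sumD periodic_sum_period add0n.
have := periodic_sumD 0 s (kappa - s); rewrite subnKC // add0n.
have := periodic_sumD 0 y (kappa - s); rewrite -El add0n.
have : (Phi y (kappa - s) <= Phi s (kappa - s))%N.
  by apply: periodic_sum_mono; rewrite /y; lia.
lia.
Qed.

End PeriodicSum.

(** * Averaging over the points of a projective space *)

Lemma card_neq0_form (F : finFieldType) (x : nat) (v : 'cV[F]_x) : v != 0 ->
  #|[set m : 'rV[F]_x | (m *m v) 0 0 != 0]|
    = ((#|F| - 1) * #|F| ^ x.-1)%N.
Proof.
move=> vn0; have [i vi0] : exists i, v i 0 != 0.
  apply/existsP; apply: contraNT vn0; rewrite negb_exists => /forallP v0.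
  by apply/eqP/colP => i; rewrite mxE; apply/eqP/negbNE/v0.
(* The form takes the value 1 at [u], so translation by [c *: u] carries its kernel onto the fibre
   over [c]; all fibres thus have equal size. *)
pose u : 'rV[F]_x := (v i 0)^-1 *: delta_mx 0 i.
have uv : (u *m v) 0 0 = 1.
  by rewrite -scalemxAl -rowE !mxE mulVf.
pose fib c := [set m : 'rV[F]_x | (m *m v) 0 0 == c].
have fibE c : #|fib c| = #|fib 0|.
  rewrite -[RHS](card_imset _ (addrI (c *: u))); apply: eq_card => m; rewrite inE.
  have mulcu m' : ((c *: u + m') *m v) 0 0 = c + (m' *m v) 0 0.
    by rewrite mulmxDl -scalemxAl mxE [X in X + _]mxE uv mulr1.
  apply/eqP/imsetP => [mc | [m' + ->]]; last first.
    by rewrite inE mulcu => /eqP ->; rewrite addr0.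
  exists (m - c *: u); last by rewrite addrC subrK.
  by rewrite inE -(inj_eq (addrI c)) -mulcu addrC subrK mc addr0.
have x_gt0 : (0 < x)%N by case: (i) => j; case: (x).
have q_gt0 : (0 < #|F|)%N by apply/card_gt0P; exists 0.
have tot : (#|F| * #|fib 0%R| = #|F| ^ x)%N.
  rewrite -[x in RHS]mul1n -card_mx -[RHS]sum1_card.
  rewrite [RHS](partition_big (fun m : 'rV_x => (m *m v) 0 0) predT) //=.
  rewrite -sum_nat_const.  apply: eq_bigr => c _.
  by rewrite -(fibE c) -sum1_card; apply: eq_bigl => m; rewrite inE.
have fib0 : #|fib 0| = (#|F| ^ x.-1)%N.
  by apply/eqP; rewrite -(eqn_pmul2l q_gt0) tot -expnS prednK.
have -> : [set m : 'rV[F]_x | (m *m v) 0 0 != 0] = ~: fib 0.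
  by apply/setP=> m; rewrite !inE.
rewrite cardsCs setCK card_mx mul1n -tot fib0; nia.
Qed.

(* Averaging over the punctured dual space: the pairs [(j, a)] with [a != 0]
   are distributed among the [q ^ x - 1] nonzero vectors [a *: v j]. *)
Lemma exists_heavy_point (F : finFieldType) (I : finType) (x delta : nat)
    (R : {set I}) (v : I -> 'cV[F]_x) :
  (0 < delta)%N -> (0 < x)%N ->
  (forall m : 'rV[F]_x, m != 0 ->
    (delta <= #|[set j in R | (m *m v j)%R 0%R 0%R != 0%R]|)%N) ->
  exists2 j0, j0 \in R & v j0 != 0 /\
    (ceil_div delta (#|F| ^ x.-1)
      <= #|[set j in R | [exists a, (a != 0) && (v j0 == a *: v j)]%R]|)%N.
Proof.
move=> delta_gt0 x_gt0 wt_ge; set q := #|F|.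
have q_gt1 : (1 < q)%N := card_finNzRing_gt1 F.
pose N := #|[set j in R | v j != 0]|.
pose fib w := [set j in R | [exists a, (a != 0) && (w == a *: v j)]].
pose M := \max_(w | w != 0) #|fib w|.
(* Double count the pairs of a nonzero [m] and a [j] in [R] with [m *m v j] nonzero. *)
have lower : (delta * (q ^ x - 1) <= N * ((q - 1) * q ^ x.-1))%N.
  have -> : (q ^ x - 1 = #|[set~ (0%R : 'rV[F]_x)]|)%N.
    by rewrite cardsC1 card_mx mul1n subn1.
  rewrite mulnC -sum_nat_const.
  apply: (@leq_trans (\sum_(m in [set~ (0%R : 'rV[F]_x)])
      \sum_(j in R | (m *m v j)%R 0%R 0%R != 0%R) 1)%N).
    apply: leq_sum => m; rewrite !inE => /wt_ge/leq_trans; apply.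
    by rewrite -sum1_card; apply: eq_leq; apply: eq_bigl => j; rewrite inE.
  rewrite (exchange_big_dep (fun j => (j \in R) && (v j != 0))) /=; last first.
    by move=> m j _ /andP[-> /=]; apply: contraNneq => ->; rewrite mulmx0 mxE.
  rewrite /N -sum1_card big_distrl /=; apply: eq_leq.
  apply: eq_big => [j | j /andP[jR vj0]]; first by rewrite inE.
  rewrite mul1n -(card_neq0_form vj0) -sum1_card.
  apply: eq_bigl => m; rewrite !inE jR; case: eqVneq => // ->.
  by rewrite mul0mx mxE eqxx.
(* Sort the pairs [(j, a)] by the vector [a *: v j]; over a given [w], the index [j] determines
   [a]. *)
have upper : (N * (q - 1) <= (q ^ x - 1) * M)%N.
  have -> : (q ^ x - 1 = #|[set~ (0%R : 'cV[F]_x)]|)%N.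
    by rewrite cardsC1 card_mx muln1 subn1.
  have -> : (N * (q - 1) = #|setX [set j in R | v j != 0%R] [set~ (0%R : F)]|)%N.
    by rewrite cardsX cardsC1 subn1.
  rewrite -sum1_card (partition_big (fun p => p.2 *: v p.1)
    (mem [set~ (0%R : 'cV[F]_x)])) /=; last first.
    case=> j a; rewrite !inE /= => /andP[/andP[_ vj0] a0].
    by rewrite scaler_eq0 negb_or a0.
  rewrite -sum_nat_const; apply: leq_sum => w; rewrite !inE => w0.
  have le_fib : (#|fib w| <= M)%N by apply: leq_bigmax_cond.
  apply: leq_trans le_fib; rewrite sum1dep_card.
  set A := [set _ | _]; have fst_inj : {in A &, injective fst}.
    move=> [j a] [j' b]; rewrite !inE /= => /andP[/andP[/andP[_ vj0] _] /eqP aw].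
    case/andP=> _ /eqP bw Ej; rewrite -Ej in bw *; congr pair.
    apply/eqP; rewrite -subr_eq0 -[_ == 0]orbF -(negbTE vj0) -scaler_eq0.
    by rewrite scalerBl aw bw subrr.
  rewrite -(card_in_imset fst_inj).
  apply/subset_leq_card/subsetP => _ /imsetP[[j a] + ->].
  rewrite !inE /= => /andP[/andP[/andP[-> _] a0] /eqP aw].
  by apply/existsP; exists a; rewrite a0 aw eqxx.
have le_M : (delta <= M * q ^ x.-1)%N.
  have qx_gt1 : (1 < q ^ x)%N by rewrite -(exp1n x) ltn_exp2r.
  rewrite -(@leq_pmul2r (q ^ x - 1)) ?subn_gt0 //.
  apply: leq_trans lower _; rewrite mulnA [leqRHS]mulnAC leq_mul2r [leqRHS]mulnC.
  by rewrite upper orbT.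
have [w w0 Mw] : {w | w != 0 & M = #|fib w|}.
  apply: eq_bigmax_cond; apply/card_gt0P; exists (const_mx 1).
  change (const_mx 1 != 0 :> 'cV[F]_x).
  apply/eqP => /matrixP/(_ (Ordinal x_gt0) 0)/eqP.
  by rewrite !mxE oner_eq0.
have M_gt0 : (0 < M)%N by case: (M) le_M => //; rewrite mul0n leqNgt delta_gt0.
have [j0] : exists j0, j0 \in fib w by apply/card_gt0P; rewrite -Mw.
rewrite inE => /andP[j0R /existsP[a /andP[a0 /eqP aw]]].
have vj0 : v j0 != 0 by apply: contraNneq w0 => v0; rewrite aw v0 scaler0.
exists j0 => //; split=> //; rewrite ceil_div_leq ?expn_gt0 ?(ltnW q_gt1) //.
apply: leq_trans le_M _; rewrite leq_mul2r Mw subset_leq_card ?orbT //.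
(* The vector [w] is a nonzero multiple of [v j0], so both represent the same projective point. *)
apply/subsetP=> j; rewrite !inE => /andP[-> /existsP[b /andP[b0 /eqP bw]]].
apply/existsP; exists (a^-1 * b); rewrite mulf_neq0 ?invr_eq0 //=.
by rewrite -scalerA -bw aw scalerA mulVf ?scale1r.
Qed.

(** * Supports and hyperplane subcodes *)

Definition code_supp (F : finFieldType) (n : nat) (C : {vspace 'rV[F]_n}) :
    {set 'I_n} :=
  [set j | [exists c : 'rV[F]_n, (c \in C) && (c 0 j != 0)]].

Section Codes.

Variables (F : finFieldType) (n : nat).
Implicit Types (C D : {vspace 'rV[F]_n}) (R : {set 'I_n}) (c : 'rV[F]_n).

Lemma code_suppP C j :
  reflect (exists2 c, c \in C & c 0 j != 0) (j \in code_supp C).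
Proof.
rewrite inE; apply: (iffP existsP) => [[c /andP[]] | [c cC cj]]; exists c => //.
by rewrite cC.
Qed.

Lemma code_suppS C D : (C <= D)%VS -> code_supp C \subset code_supp D.
Proof.
move=> /subvP sCD; apply/subsetP => j /code_suppP[c /sCD cD cj].
by apply/code_suppP; exists c.
Qed.

Lemma code_supp_neq0 C : (0 < \dim C)%N -> exists j, j \in code_supp C.
Proof.
rewrite lt0n dimv_eq0 -vpick0 => c0.
have [j cj] : exists j, vpick C 0 j != 0.
  apply/existsP; apply: contraNT c0; rewrite negb_exists => /forallP c0.
  by apply/eqP/rowP => i; rewrite mxE; apply/eqP/negbNE/c0.
by exists j; apply/code_suppP; exists (vpick C); rewrite ?memv_pick.
Qed.

Lemma min_dist_geS C D d : (C <= D)%VS -> min_dist_ge D d -> min_dist_ge C d.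
Proof.
move=> /subvP sCD /forallP dD; apply/forallP => x; apply/forallP => y.
apply/implyP => /and3P[/sCD xD /sCD yD xy].
by have /forallP/(_ y)/implyP := dD x; apply; rewrite xD yD.
Qed.

Lemma restr_codeS C D R : (C <= D)%VS -> (restr_code C R <= restr_code D R)%VS.
Proof. exact: limgS. Qed.

Lemma lker_restrP R c :
  reflect (forall j, j \in R -> c 0 j = 0)
    (c \in lker (linfun (@restr_word F n R))).
Proof.
rewrite memv_ker lfunE /=; apply: (iffP eqP) => [c0 j jR | c0].
  by move/rowP/(_ (enum_rank_in jR j)): c0; rewrite !mxE enum_rankK_in.
by apply/rowP=> i; rewrite !mxE c0 ?enum_valP.
Qed.

Lemma restr_wt_ge C R d c : min_dist_ge (restr_code C R) d -> c \in C ->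
  c \notin lker (linfun (@restr_word F n R)) ->
  (d <= #|[set j in R | (c 0 j != 0)%R]|)%N.
Proof.
move=> /forallP/(_ (restr_word R c))/forallP/(_ 0)/implyP dC cC.
rewrite memv_ker lfunE /= => c0; apply: leq_trans (dC _) _.
  by rewrite mem0v c0 -[restr_word R c]lfunE memv_img.
rewrite /hamming_dist -(card_imset _ enum_val_inj); apply/subset_leq_card/subsetP.
by move=> _ /imsetP[i + ->]; rewrite !inE !mxE enum_valP.
Qed.

(** [C'] consists of the words of [C] vanishing at a heavy coordinate [j0] of [R]; every coordinate
    of [R] proportional to [j0] on [C] then leaves the support. *)
Lemma hyperplane_subcode C R delta : (0 < delta)%N ->
  min_dist_ge (restr_code C R) delta -> (0 < \dim (restr_code C R))%N ->
  exists C' : {vspace 'rV[F]_n},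
    [/\ (C' <= C)%VS, (\dim C').+1 = \dim C,
        (\dim (restr_code C' R)).+1 = \dim (restr_code C R)
      & (#|code_supp C'| + ceil_div delta (#|F| ^ (\dim (restr_code C R)).-1)
          <= #|code_supp C|)%N].
Proof.
move=> delta_gt0 dC x_gt0; set Z := lker (linfun (@restr_word F n R)).
(* Restriction to [R] is injective on the complement [U] of its kernel [K] in [C], so [U] stands for
   [C|_R]; the column [v j] is the coordinate form [j] in a basis of [U]. *)
pose K := (C :&: Z)%VS; pose U := (C :\: K)%VS; pose B := vbasis U.
have sUC : (U <= C)%VS := diffvSl C K.
have dimU : \dim U = \dim (restr_code C R).
  apply/eqP; rewrite -(eqn_add2l (\dim K)) limg_ker_dim.
  by rewrite -(dimv_cap_compl C K) /K capvA capvv.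
pose v j : 'cV[F]_(\dim U) := \col_t B`_t 0 j.
pose word (m : 'rV[F]_(\dim U)) := \sum_t m 0 t *: B`_t.
have wordE m j : word m 0 j = (m *m v j) 0 0.
  by rewrite summxE mxE; apply: eq_bigr => t _; rewrite !mxE.
have word_U m : word m \in U.
  by apply: memv_suml => t _; rewrite memvZ //;
    rewrite (basis_mem (vbasisP U)) ?mem_nth ?size_tuple.
have word_Z m : word m \in Z -> m = 0.
  move=> wZ; have : word m \in (U :&: K)%VS.
    by rewrite !memv_cap word_U (subvP sUC) ?word_U.
  rewrite capv_diff memv0 => /eqP /freeP m0.
  by apply/rowP => t; rewrite m0 ?mxE // (basis_free (vbasisP U)).
have wordK c : c \in U -> exists m, c = word m.
  move=> cU; exists (\row_t coord B t c); rewrite {1}(coord_vbasis cU).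
  by apply: eq_bigr => t _; rewrite mxE.
have v_supp j : v j != 0 -> j \in code_supp C.
  move=> vj0; apply/code_suppP.
  have [t vt] : exists t, v j t 0 != 0.
    apply/existsP; apply: contraNT vj0; rewrite negb_exists => /forallP v0.
    by apply/eqP/colP => i; rewrite [RHS]mxE; apply/eqP/negbNE/v0.
  exists B`_t; last by rewrite mxE in vt.
  by rewrite (subvP sUC) ?(basis_mem (vbasisP U)) ?mem_nth ?size_tuple.
have wt_ge (m : 'rV[F]_(\dim U)) : m != 0%R ->
    (delta <= #|[set j in R | ((m *m v j) 0 0 != 0)%R]|)%N.
  move=> m0; have := restr_wt_ge (c := word m) dC (subvP sUC _ (word_U m)).
  under eq_finset do rewrite wordE; apply.
  by apply: contraNN m0 => /word_Z ->.
have [|j0 j0R [vj0 heavy]] := exists_heavy_point delta_gt0 _ wt_ge.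
  by rewrite dimU.
pose Z0 := lker (linfun (@restr_word F n [set j0])).
have Z0P c : (c \in Z0) = (c 0 j0 == 0).
  apply/lker_restrP/eqP => [-> // | c0 j /set1P -> //]; exact: set11.
have sKZ0 : (K <= Z0)%VS.
  by apply/subvP => c; rewrite memv_cap Z0P => /andP[_ /lker_restrP ->].
exists (C :&: Z0)%VS.
have dimC' : (\dim (C :&: Z0)).+1 = \dim C.
  have := limg_ker_dim (linfun (@restr_word F n [set j0])) C;
  rewrite -/Z0 => <-.
  rewrite -addn1; congr addn; apply/esym/eqP; rewrite eqn_leq.
  apply/andP; split.
    by apply: leq_trans (dimvS (subvf _)) _; rewrite dimvf /dim /= cards1.
  have /code_suppP[c cC cj0] := v_supp _ vj0.
  rewrite lt0n dimv_eq0; apply: contraNneq cj0 => im0; rewrite -Z0P memv_ker.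
  by rewrite -memv0 -im0 memv_img.
(* As [j0] lies in [R], the kernel of restriction is unchanged, so [C|_R] loses exactly the one
   dimension that [C] loses. *)
have KC' : (C :&: Z0 :&: Z)%VS = K.
  by rewrite -capvA [(Z0 :&: Z)%VS]capvC capvA; apply/capv_idPl.
split=> //; first exact: capvSl.
  have := limg_ker_dim (linfun (@restr_word F n R)) (C :&: Z0).
  have := limg_ker_dim (linfun (@restr_word F n R)) C.
  rewrite -/Z KC' -dimC' => dimR dimR'; apply/eqP.
  by rewrite -(eqn_add2l (\dim K)) dimR -[in eqbRHS]dimR' addnS.
rewrite -dimU; apply: leq_trans (leq_add (leqnn _) heavy) _.
rewrite -(cardsID (code_supp (C :&: Z0)) (code_supp C)) leq_add //.
  by rewrite (setIidPr _) // code_suppS ?capvSl.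
apply/subset_leq_card/subsetP => j.
rewrite inE => /andP[jR /existsP[a /andP[a0 /eqP avj]]].
rewrite in_setD v_supp ?andbT; last first.
  by apply: contraNneq vj0 => vj; rewrite avj vj scaler0.
apply/negP => /code_suppP[c]; rewrite memv_cap Z0P => /andP[cC cj0] /eqP; apply.
(* On [R] only the component in [U] matters, and there vanishing at [j0] forces vanishing at [j]. *)
move: cC cj0; rewrite -(addv_diff_cap C K) => /memv_addP[u uU [w + ->]].
rewrite !memv_cap => /and3P[_ _ /lker_restrP w0].
have [m ->] := wordK _ uU; rewrite !mxE !w0 // !addr0.
rewrite !wordE avj -scalemxAr mxE mulf_eq0 (negbTE a0) => /eqP //.
Qed.

End Codes.

(** * Deleting the coordinates outside the support *)

Lemma min_dist_ge0 (F : finFieldType) (n d : nat) :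
  min_dist_ge (0%VS : {vspace 'rV[F]_n}) d.
Proof.
apply/forallP => x; apply/forallP => y; apply/implyP.
by rewrite !memv0 => /and3P[/eqP-> /eqP->]; rewrite eqxx.
Qed.

(** Words of [C] differ only on the support, so one keeps these coordinates and pads with zeros up
    to length [m]. *)
Lemma code_on_supp (F : finFieldType) (n m : nat) (C : {vspace 'rV[F]_n}) :
  (#|code_supp C| <= m)%N ->
  exists2 D : {vspace 'rV[F]_m}, \dim D = \dim C
    & forall d, min_dist_ge C d -> min_dist_ge D d.
Proof.
case: m => [|m] leS.
  exists 0%VS => [|d _]; last exact: min_dist_ge0.
  rewrite dimv0; apply/esym/eqP/negPn; rewrite -lt0n; apply/negP.
  case/code_supp_neq0 => j; move: leS; rewrite leqn0 cards_eq0 => /eqP->.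
  by rewrite inE.
set S := code_supp C in leS *.
pose P : 'M[F]_(n, m.+1) :=
  \matrix_(j, i) ((j \in S) && (index j (enum S) == i))%:R.
pose idx j : 'I_m.+1 := inord (index j (enum S)).
have idxE j : j \in S -> idx j = index j (enum S) :> nat.
  by move=> jS; rewrite inordK // (leq_trans _ leS) // cardE index_mem mem_enum.
have PE (c : 'rV[F]_n) j : j \in S -> (c *m P) 0 (idx j) = c 0 j.
  move=> jS; rewrite mxE (bigD1 j) //= big1 => [|j' j'j].
    by rewrite mxE jS idxE // eqxx mulr1 addr0.
  rewrite mxE; case j'S: (j' \in S); last by rewrite mulr0.
  rewrite idxE //; case: eqP => [E|_]; last by rewrite mulr0.
  by case/eqP: j'j; apply: index_inj E; rewrite ?mem_enum.
have hamming_le x y : x \in C -> y \in C ->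
    (hamming_dist x y <= hamming_dist (x *m P) (y *m P))%N.
  move=> xC yC; have sub j : x 0 j != y 0 j -> j \in S.
    move=> xy; apply/code_suppP; exists (x - y); first exact: memvB.
    by rewrite !mxE subr_eq0.
  have idx_inj : {in [set j | x 0 j != y 0 j] &, injective idx}.
    move=> j j'; rewrite !inE => /sub jS /sub j'S /(congr1 val) /=.
    by rewrite !idxE // => /index_inj -> //; rewrite mem_enum.
  rewrite /hamming_dist -(card_in_imset idx_inj).
  apply/subset_leq_card/subsetP => _ /imsetP[j + ->]; rewrite !inE => xy.
  by rewrite !PE ?sub.
pose f : 'Hom('rV[F]_n, 'rV[F]_m.+1) := linfun (mulmxr P).
have fE c : f c = c *m P by rewrite lfunE.
exists (f @: C)%VS => [|d /forallP dC].
  (* Injectivity on [C] is the distance inequality [hamming_le] against the zero word. *)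
  apply: limg_dim_eq; apply/eqP; rewrite -subv0; apply/subvP => c.
  rewrite memv_cap memv_ker fE memv0 => /andP[cC /eqP c0].
  have := hamming_le c 0 cC (mem0v C).
  rewrite c0 mul0mx [X in (_ <= X)%N -> _]eq_card0; last by move=> i; rewrite !inE eqxx.
  rewrite leqn0 cards_eq0 => /eqP/setP c_0; apply/eqP/rowP => j.
  by have := c_0 j; rewrite !inE => /negbFE/eqP.
apply/forallP => x'; apply/forallP => y'; apply/implyP.
case/and3P=> /memv_imgP[x xC ->] /memv_imgP[y yC ->] xy; rewrite !fE.
apply: leq_trans (hamming_le x y xC yC).
have /forallP/(_ y)/implyP := dC x; apply; rewrite xC yC.
by apply: contraNneq xy => ->.
Qed.

Lemma leq_kopt_nat (F : finFieldType) (n m d : nat) (C : {vspace 'rV[F]_n}) :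
  min_dist_ge C d -> (#|code_supp C| <= m)%N -> (\dim C <= kopt_nat F m d)%N.
Proof.
move=> dC /code_on_supp[D <- dD].
exact: (leq_bigmax_cond (F := fun D : {vspace 'rV[F]_m} => \dim D)) (dD d dC).
Qed.

(** * Shortening along repair sets *)

Section LocallyRepairable.

Variables (F : finFieldType) (n r delta kappa : nat).
Hypothesis delta_gt0 : (0 < delta)%N.
Hypothesis kappaP : dim_upper_bound F (r + delta - 1) delta kappa.
Implicit Types (C : {vspace 'rV[F]_n}) (R : {set 'I_n}).

Local Notation Phi :=
  (periodic_sum (fun i => ceil_div delta (#|F| ^ i)) kappa).

Lemma ceil_div_expn_anti i j : (i <= j)%N ->
  (ceil_div delta (#|F| ^ j) <= ceil_div delta (#|F| ^ i))%N.
Proof.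
have q_gt1 := card_finNzRing_gt1 F; have q_gt0 := ltnW q_gt1.
by move=> le_ij; rewrite leq_ceil_div // expn_gt0 q_gt0 leq_pexp2l.
Qed.

(** A smaller [R] is handled by padding the restricted code to the length required by [kappaP]. *)
Lemma dim_restr_code_le C R : (#|R| <= r + delta - 1)%N ->
  min_dist_ge (restr_code C R) delta -> (\dim (restr_code C R) <= kappa)%N.
Proof.
move=> R_le dR; have [|D <- dD] := @code_on_supp _ _ (r + delta - 1) (restr_code C R).
  by apply: leq_trans (max_card _) _; rewrite card_ord.
by apply: kappaP; apply: dD.
Qed.

Lemma dim_restr_code_gt0 C R j : j \in R -> j \in code_supp C ->
  (0 < \dim (restr_code C R))%N.
Proof.
move=> jR /code_suppP[c cC]; rewrite lt0n dimv_eq0; apply: contraNneq => R0.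
have cR : c \in lker (linfun (@restr_word F n R)).
  by rewrite memv_ker -memv0 -R0 memv_img.
by apply/eqP; move/lker_restrP: cR; apply.
Qed.

Lemma all_symbol_localityS C D : (C <= D)%VS ->
  all_symbol_locality r delta D -> all_symbol_locality r delta C.
Proof.
move=> sCD locD j; have [R [jR R_le dR]] := locD j.
by exists R; split=> //; apply: min_dist_geS dR; apply: restr_codeS.
Qed.

(* The subcode is cut out one hyperplane at a time, always inside a current
   repair set [R]; the offset of [Phi] is the position of [dim (C|_R)] in the
   cycle [kappa, kappa - 1, ..., 1]. *)
Lemma shorten_in_repair_set l C R :
  all_symbol_locality r delta C -> min_dist_ge (restr_code C R) delta ->
  (\dim (restr_code C R) <= kappa)%N -> (l <= \dim C)%N ->
  exists C' : {vspace 'rV[F]_n},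
    [/\ (C' <= C)%VS, (l + \dim C' = \dim C)%N
      & (#|code_supp C'| + Phi (kappa - \dim (restr_code C R)) l
          <= #|code_supp C|)%N].
Proof.
elim: l C R => [|l IHl] C R locC dR x_le l_le.
  by exists C; rewrite /periodic_sum big_ord0 addn0.
(* If [C|_R = 0], the offset [kappa] amounts to 0. Moving to a repair set of a coordinate in the
   support changes the offset, which cannot decrease the window sum. *)
wlog x_gt0 : R dR x_le / (0 < \dim (restr_code C R))%N.
  move=> IH; have [x0|] := posnP (\dim (restr_code C R)); last exact: IH.
  have [j jC] := code_supp_neq0 (leq_trans (ltn0Sn l) l_le).
  have [R' [jR' R'_le dR']] := locC j.
  have x'_gt0 := dim_restr_code_gt0 jR' jC.
  have x'_le := dim_restr_code_le R'_le dR'.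
  have [C' [sC' dimC' suppC']] := IH _ dR' x'_le x'_gt0; exists C'; split=> //.
  apply: leq_trans suppC'; rewrite leq_add2l x0 subn0 -[kappa in Phi kappa]add0n.
  rewrite periodic_sum_period periodic_sum_min ?leq_subr //.
    exact: leq_trans x'_le.
  exact: ceil_div_expn_anti.
have [D [sDC dimD dimDR suppD]] := hyperplane_subcode delta_gt0 dR x_gt0.
have [|||C' [sC' dimC' suppC']] := IHl D R (all_symbol_localityS sDC locC).
- exact: min_dist_geS (restr_codeS _ sDC) dR.
- by rewrite -dimDR in x_le; apply: ltnW.
- by rewrite -dimD in l_le.
exists C'; split; first exact: subv_trans sDC.
  by rewrite addSn dimC'.
apply: leq_trans suppD; rewrite periodic_sum_recl modn_small; last by lia.
have -> : (kappa.-1 - (kappa - \dim (restr_code C R))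
    = (\dim (restr_code C R)).-1)%N.
  by lia.
rewrite addnCA addnC leq_add2r; apply: leq_trans suppC'.
by rewrite leq_add2l -dimDR subnSK ?dimDR.
Qed.

(** Start from the empty set as an exhausted repair set: its offset [kappa] is equivalent to 0. *)
Lemma exists_short_subcode l C : all_symbol_locality r delta C ->
  (l <= \dim C)%N ->
  exists C' : {vspace 'rV[F]_n},
    [/\ (C' <= C)%VS, (l + \dim C' = \dim C)%N
      & (#|code_supp C'| + Phi 0 l <= #|code_supp C|)%N].
Proof.
move=> locC l_le.
have R0 : \dim (restr_code C set0) = 0%N.
  apply/eqP; rewrite -leqn0; apply: leq_trans (dimvS (subvf _)) _.
  by rewrite dimvf /dim /= cards0.
have [|||C'] := @shorten_in_repair_set l C set0 locC; rewrite ?R0 //.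
  move/eqP: R0; rewrite dimv_eq0 => /eqP ->; exact: min_dist_ge0.
by rewrite subn0 -[kappa in Phi kappa]add0n periodic_sum_period; exists C'.
Qed.

End LocallyRepairable.

(** * Attaining the minimum and concluding the bound *)

Lemma exists_minimum (f : nat -> nat) : (forall i, (i <= f i)%N) ->
  exists m, is_minimum f m.
Proof.
move=> f_ge; pose i0 : 'I_(f 0%N).+1 := ord0.
(* Arguments beyond [f 0] have values above [f 0], so a finite search suffices. *)
case: (arg_minnP (fun i : 'I_(f 0%N).+1 => f i) (isT : xpredT i0)) => i _ min_i.
exists (f i); split=> [|j]; first by exists i.
have [lt_j|/ltnW le_j] := ltnP j (f 0%N).+1.
  exact: (min_i (Ordinal lt_j)).
exact: leq_trans (min_i i0 isT) (leq_trans le_j (f_ge j)).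
Qed.

Theorem theorem2 (F : finFieldType) (n k d r delta kappaB : nat)
    (C : {vspace 'rV[F]_n})
    (hr : (0 < r)%N) (hdelta : (0 < delta)%N)
    (hC : linear_code k d C)
    (hloc : all_symbol_locality r delta C)
    (hkappaB : dim_upper_bound F (r + delta - 1) delta kappaB) :
  exists2 m : nat,
    is_minimum
      (fun lambda : nat =>
         let a := (lambda %/ kappaB)%N in
         let b := (lambda %% kappaB)%N in
         (lambda +
          kopt F (n%:Z - (a + 1)%:Z * (griesmer #|F| kappaB delta)%:Z
                  + (griesmer #|F| (kappaB - b) delta)%:Z) d)%N) m
    & (k <= m)%N.
Proof.
case: hC => dimC k_gt0 [dC _].
(* A repair set of a coordinate in the support carries a nonzero restricted code. *)
have kappa_gt0 : (0 < kappaB)%N.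
  rewrite -dimC in k_gt0; have [j jC] := code_supp_neq0 k_gt0.
  have [R [jR R_le dR]] := hloc j.
  apply: leq_trans (dim_restr_code_gt0 jR jC) _.
  exact: dim_restr_code_le R_le dR.
have [m m_min] := exists_minimum (fun i => leq_addr (kopt F
  (n%:Z - (i %/ kappaB + 1)%:Z * (griesmer #|F| kappaB delta)%:Z
    + (griesmer #|F| (kappaB - i %% kappaB) delta)%:Z) d) i).
exists m => //; have [[l <-] _] := m_min.
have [lt_kl | le_lk] := ltnP k l.
  exact: leq_trans (ltnW lt_kl) (leq_addr _ _).
rewrite -dimC in le_lk *.
have [C' [sC'C <- suppC']] := exists_short_subcode hdelta hkappaB hloc le_lk.
rewrite leq_add2l.
set Phi := periodic_sum _ _ _ _ in suppC'.
have Phi_le : (#|code_supp C'| + Phi <= n)%N.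
  by apply: leq_trans suppC' _; rewrite -[n in leqRHS]card_ord max_card.
have := periodic_sum_full (fun i => ceil_div delta (#|F| ^ i))%N (l %/ kappaB)%N
  (ltnW (ltn_pmod l kappa_gt0)).
rewrite -divn_eq -/Phi => PhiE.
(* Since [Phi <= n], the integer length is nonnegative and [kopt] reduces to [kopt_nat]. *)
set z := (_ - _ + _ : int); have -> : z = (n - Phi)%N.
  rewrite /z /griesmer addn1; lia.
by apply: leq_kopt_nat; [exact: min_dist_geS dC | lia].
Qed.
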